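(* Let $x_{\rm e},y_{\rm e},u_{\rm e},x_{\rm o},y_{\rm o},u_{\rm o},\lambda$ be indeterminates and for $n,k\ge0$ let $$\widehat Q_{n,k}=\sum_{G\in\mathbf{LD}^{\rm alt\infty}_{n,k}}x_{\rm e}^{A_{\rm e}(G)}\,y_{\rm e}^{V_{\rm e}(G)}\,u_{\rm e}^{B_{\rm e}(G)}\,x_{\rm o}^{A_{\rm o}(G)}\,y_{\rm o}^{V_{\rm o}(G)}\,u_{\rm o}^{B_{\rm o}(G)}\,\lambda^{\mathrm{cyc}(G)}.$$ Let $\boldsymbol\alpha=(\alpha_m)_{m\ge1}$ with, for $m\ge1$, $\alpha_{2m-1}=(\lambda+2m-2)[x_{\rm e}+(2m-2)u_{\rm e}]\,y_{\rm o}$ and $\alpha_{2m}=(\lambda+2m-1)[x_{\rm o}+(2m-1)u_{\rm o}]\,y_{\rm e}$. Then for all $n,k\ge0$, $$\widehat Q_{2n,2k}=y_{\rm e}^k y_{\rm o}^k\,S_{n,k}(\boldsymbol\alpha),\qquad \widehat Q_{2n+1,2k+1}=y_{\rm e}^k y_{\rm o}^{k+1}\,S'_{n,k}(\boldsymbol\alpha).$$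
   Context: $S_{n,k}(\boldsymbol\alpha)$ is the generating polynomial of lattice paths in $\mathbb Z\times\mathbb N$ from $(0,0)$ to $(2n,2k)$ with steps $(1,1)$ (weight 1) and $(1,-1)$ (weight $\alpha_i$ when falling from height $i$); $S'_{n,k}(\boldsymbol\alpha)$ is the same for paths from $(0,0)$ to $(2n+1,2k+1)$. A Laguerre digraph on $[n]$ is a directed graph on $[n]$ (loops allowed) with all in- and out-degrees in $\{0,1\}$; components are directed paths (isolated vertices included) and directed cycles (loops included); $\mathrm{cyc}(G)$ is the number of cycles. With $\infty$–$\infty$ boundary conditions, $p(i)$ is the predecessor of $i$ (or $\infty$ if in-degree 0), $s(i)$ the successor (or $\infty$ if out-degree 0), $\infty$ exceeding all integers. $i$ is a peak if $p(i)<i>s(i)$, valley if $p(i)>i<s(i)$, double ascent if $p(i)<i<s(i)$, double descent if $p(i)>i>s(i)$, fixed point if $p(i)=i=s(i)$. $G$ is alternating if it has none of the last three kinds; $\mathbf{LD}^{\rm alt\infty}_{n,k}$ is the set of alternating Laguerre digraphs on $[n]$ with exactly $k$ paths. In the predecessor word $p(1)\cdots p(n)$ (alphabet $[n]\cup\{\infty\}$), a letter $v$ is a record value if $v=p(i)$ for some position $i$ with $p(j)<p(i)$ for all $j<i$. $A_{\rm e}(G)$ = number of even peaks of $G$ that are record values of the predecessor word; $B_{\rm e}(G)$ = number of even peaks of $G$ that are not record values of the predecessor word; $V_{\rm e}(G)$ = number of even valleys of $G$; $A_{\rm o},B_{\rm o},V_{\rm o}$ are the same with odd vertices. *)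

(* Defs.v *)
From mathcomp Require Import all_boot all_order all_algebra.
From mathcomp Require Import mpoly.

Set Implicit Arguments.
Unset Strict Implicit.
Unset Printing Implicit Defensive.

Import GRing.Theory.

Local Open Scope ring_scope.

(* A directed graph on [n], loops allowed: a set of arcs (i, j), i -> j.
   The integer i in [n] = {1, ..., n} is represented by the ordinal i - 1;
   only parities see this shift. *)
Definition digraph (n : nat) := {set 'I_n * 'I_n}.

Section Digraph.
Variables (n : nat) (G : digraph n).
Implicit Types (i j : 'I_n) (C : {set 'I_n}).

Definition has_arc i j : bool := (i, j) \in G.

Definition in_deg i : nat := #|[set j | has_arc j i]|.
Definition out_deg i : nat := #|[set j | has_arc i j]|.

Definition is_laguerre : bool :=
  [forall i, (in_deg i <= 1)%N && (out_deg i <= 1)%N].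

Definition components : {set {set 'I_n}} :=
  equivalence_partition (connect (fun i j => has_arc i j || has_arc j i)) [set: 'I_n].

(* The subdigraph induced on C is a directed path, resp. a directed cycle,
   on #|C| vertices (#|C| = 1: an isolated vertex, resp. a loop). *)
Definition is_dipath C : bool :=
  [exists t : #|C|.-tuple 'I_n, (C == [set x in t]) &&
    [forall a : 'I_#|C|, forall b : 'I_#|C|,
       has_arc (tnth t a) (tnth t b) == (b == a.+1 :> nat)]].

Definition is_dicycle C : bool :=
  [exists t : #|C|.-tuple 'I_n, (C == [set x in t]) &&
    [forall a : 'I_#|C|, forall b : 'I_#|C|,
       has_arc (tnth t a) (tnth t b) == (b == a.+1 %% #|C| :> nat)%N]].

Definition npaths : nat := #|[set C in components | is_dipath C]|.
Definition cyc : nat := #|[set C in components | is_dicycle C]|.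

(* Letters of [n] U {oo}, with oo represented by None. *)
Definition letter := option 'I_n.

Definition letter_lt (u v : letter) : bool :=
  match u, v with
  | Some i, Some j => (i < j)%N
  | Some _, None => true
  | None, _ => false
  end.

Definition pred_of i : letter := [pick j | has_arc j i].
Definition succ_of i : letter := [pick j | has_arc i j].

Definition peak i : bool :=
  letter_lt (pred_of i) (Some i) && letter_lt (succ_of i) (Some i).
Definition valley i : bool :=
  letter_lt (Some i) (pred_of i) && letter_lt (Some i) (succ_of i).
Definition double_ascent i : bool :=
  letter_lt (pred_of i) (Some i) && letter_lt (Some i) (succ_of i).
Definition double_descent i : bool :=
  letter_lt (Some i) (pred_of i) && letter_lt (succ_of i) (Some i).
Definition fixed_point i : bool :=
  (pred_of i == Some i) && (succ_of i == Some i).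

Definition alternating : bool :=
  [forall i, ~~ [|| double_ascent i, double_descent i | fixed_point i]].

Definition record_value (v : letter) : bool :=
  [exists i, (v == pred_of i) &&
    [forall j : 'I_n, (j < i)%N ==> letter_lt (pred_of j) (pred_of i)]].

Definition even_vertex i : bool := ~~ odd i.+1.
Definition odd_vertex i : bool := odd i.+1.

Definition Ae : nat := #|[set i | [&& even_vertex i, peak i & record_value (Some i)]]|.
Definition Be : nat := #|[set i | [&& even_vertex i, peak i & ~~ record_value (Some i)]]|.
Definition Ve : nat := #|[set i | even_vertex i && valley i]|.
Definition Ao : nat := #|[set i | [&& odd_vertex i, peak i & record_value (Some i)]]|.
Definition Bo : nat := #|[set i | [&& odd_vertex i, peak i & ~~ record_value (Some i)]]|.
Definition Vo : nat := #|[set i | odd_vertex i && valley i]|.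

End Digraph.

Definition LDalt (n k : nat) : {set digraph n} :=
  [set G : digraph n | [&& is_laguerre G, alternating G & npaths G == k]].

Notation Zpoly7 := {mpoly int[7]}.

Definition xe : Zpoly7 := 'X_(inord 0).
Definition ye : Zpoly7 := 'X_(inord 1).
Definition ue : Zpoly7 := 'X_(inord 2).
Definition xo : Zpoly7 := 'X_(inord 3).
Definition yo : Zpoly7 := 'X_(inord 4).
Definition uo : Zpoly7 := 'X_(inord 5).
Definition lam : Zpoly7 := 'X_(inord 6).

Definition Qhat (n k : nat) : Zpoly7 :=
  \sum_(G in LDalt n k)
    xe ^+ Ae G * ye ^+ Ve G * ue ^+ Be G *
    xo ^+ Ao G * yo ^+ Vo G * uo ^+ Bo G * lam ^+ cyc G.

Section LatticePaths.
Variable R : comNzRingType.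

(* A path from (0,0) with N steps (1,1) (true) or (1,-1) (false);
   height t j is the ordinate at abscissa j. *)
Definition height (N : nat) (t : N.-tuple bool) (j : nat) : int :=
  \sum_(i < N | (i < j)%N) (if tnth t i then 1 else -1).

Definition is_path (N K : nat) (t : N.-tuple bool) : bool :=
  [forall j : 'I_N.+1, 0 <= height t j] && (height t N == K%:Z).

Definition path_weight (alpha : nat -> R) (N : nat) (t : N.-tuple bool) : R :=
  \prod_(i < N) (if tnth t i then 1 else alpha `|height t i|%N).

(* Generating polynomial of the paths in Z x N from (0,0) to (N,K). *)
Definition path_poly (alpha : nat -> R) (N K : nat) : R :=
  \sum_(t : N.-tuple bool | is_path K t) path_weight alpha t.

Definition S_poly (alpha : nat -> R) (n k : nat) : R :=
  path_poly alpha (2 * n) (2 * k).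
Definition S'_poly (alpha : nat -> R) (n k : nat) : R :=
  path_poly alpha (2 * n).+1 (2 * k).+1.

End LatticePaths.

(* Main.v *)
Require Import Defs.
From mathcomp Require Import all_boot all_order all_algebra.
From mathcomp Require Import mpoly.

(* Build G by inserting the vertices 1, ..., N in increasing order. In an
   alternating Laguerre digraph the largest vertex N is either an isolated valley,
   or a peak joining the end a of one path to the start b of another (possibly the
   same) path of the digraph induced on [N - 1]; conversely every pair (a, b) is
   allowed. If there are h paths before the insertion, then h of the h^2 pairs, one
   for each b, close a cycle, and N is a record value exactly when b is the smallest
   of the h starts, since every vertex smaller than b must already have a
   predecessor. Hence peaks contribute (lambda + h - 1)(x + (h - 1) u), the number
   of paths evolves as the height of a lattice path, and a weight y on rises to
   height h can be moved to the matching falls from height h, up to one unmatched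
   rise for each height at most the final one. *)

Set Implicit Arguments.
Unset Strict Implicit.
Unset Printing Implicit Defensive.

Import GRing.Theory.

(** * Relations with unique successors and predecessors *)

Section PartialInjection.
Variables (T : finType) (e : rel T).
Hypothesis e_fun : forall x y z, e x y -> e x z -> y = z.
Hypothesis e_inj : forall x y z, e x z -> e y z -> x = y.

Definition source x := [forall y, ~~ e y x].
Definition sink x := [forall y, ~~ e x y].
Definition component x := [set y | connect (fun i j => e i j || e j i) x y].

Lemma connect_first (R : rel T) x y :
  connect R x y -> x = y \/ exists2 z, R x z & connect R z y.
Proof.
case/connectP=> [[|z p] /= xp ->]; first by left.
case/andP: xp => xz zp; right; exists z => //; by apply/connectP; exists p.
Qed.

Lemma connect_last (R : rel T) x y :
  connect R x y -> x = y \/ exists2 z, connect R x z & R z y.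
Proof.
case/connectP=> p; case/lastP: p => [|p z] /= xp ->; first by left.
move: xp; rewrite rcons_path last_rcons => /andP[xp pz]; right.
by exists (last x p) => //; apply/connectP; exists p.
Qed.

Lemma source_connect x y : source y -> connect e x y -> x = y.
Proof. by move=> /forallP sy /connect_last[//|[z _]]; rewrite (negPf (sy z)). Qed.

Lemma sink_connect x y : sink x -> connect e x y -> x = y.
Proof. by move=> /forallP sx /connect_first[//|[z]]; rewrite (negPf (sx z)). Qed.

(** Successors are unique, so two directed walks from the same vertex share their arcs until the
    shorter one stops. *)
Lemma connect_fork x y z :
  connect e x y -> connect e x z -> connect e y z || connect e z y.
Proof.
case/connectP=> p; elim: p x => [|w p IH] x /=; first by move=> _ -> ->.
case/andP=> xw wp yE /connect_first[<-|[w' xw' w'z]].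
  by apply/orP; right; apply/connectP; exists (w :: p) => //=; rewrite xw.
by apply: (IH w) => //; rewrite (e_fun xw xw').
Qed.

(** Induction along an undirected walk: by uniqueness of successors and predecessors, each further
    arc either prolongs the directed walk found so far or runs back along it. *)
Lemma component_total x y : y \in component x -> connect e x y || connect e y x.
Proof.
rewrite inE => /connectP[p]; elim/last_ind: p y => [|p w IH] y.
  by move=> _ ->; rewrite connect0.
rewrite rcons_path last_rcons => /andP[xp pw] ->.
have {IH} := IH _ xp erefl; set z := last x p in pw *.
case/orP: pw => [zw|wz] /orP[xz|zx].
- by rewrite (connect_trans xz (connect1 zw)).
- case: (connect_first zx) => [<-|[w' zw' w'x]]; first by rewrite connect1.
  by rewrite (e_fun zw zw') w'x orbT.
- case: (connect_last xz) => [->|[w' xw' w'z]]; first by rewrite (connect1 wz) orbT.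
  by rewrite (e_inj wz w'z) xw'.
- by rewrite (connect_trans (connect1 wz) zx) orbT.
Qed.

Lemma mem_component x y : connect e x y -> y \in component x.
Proof. by rewrite inE; apply: connect_sub => u v uv; rewrite connect1 ?uv. Qed.

Lemma component_eq x y : (y \in component x) -> component x = component y.
Proof.
rewrite inE => xy; apply/setP=> z; rewrite !inE.
by apply: same_connect => //; apply: sym_connect_sym => u v; rewrite orbC.
Qed.

(* The successor map is injective on the finite set of points reachable from x;
   without sinks it is a bijection of that set, and x is attained. *)
Lemma reach_sink x :
  (exists2 a, sink a & connect e x a) \/ (exists2 a, e a x & connect e x a).
Proof.
pose f z := odflt z [pick y | e z y]; pose D := [set y | connect e x y].
case: (boolP [exists a in D, sink a]) => [/exists_inP[a]|/exists_inPn nosink].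
  by rewrite inE; left; exists a.
have ef z : z \in D -> e z (f z).
  move=> /nosink; rewrite negb_forall => /existsP[y]; rewrite negbK /f => zy.
  by case: pickP => [//|/(_ y)]; rewrite zy.
have sub : f @: D \subset D.
  apply/subsetP=> _ /imsetP[z zD ->]; move: (ef z zD); move: zD; rewrite !inE.
  by move=> xz /connect1; apply: connect_trans.
have eqD : f @: D = D.
  apply/eqP; rewrite eqEcard sub card_in_imset ?leqnn //.
  by move=> u v uD vD fuv; apply: (@e_inj _ _ (f u)); rewrite ?ef // fuv ef.
have: x \in f @: D by rewrite eqD inE connect0.
case/imsetP=> a aD xfa; right; exists a; first by rewrite xfa; apply: ef.
by move: aD; rewrite inE.
Qed.

Definition oncyc x := [exists a, e a x && connect e x a].

(** A walk cannot leave a cycle: the next arc of the walk is also the first arc of the way back to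
    [x]. *)
Lemma oncyc_back x z : oncyc x -> connect e x z -> connect e z x.
Proof.
case/existsP=> a /andP[ax xa] /connectP[p]; elim/last_ind: p z => [|p w IH] z.
  by move=> _ ->.
rewrite rcons_path last_rcons => /andP[xp pw] ->.
case: (connect_first (IH _ xp erefl)) => [lx|[w' pw' w'x]]; last first.
  by rewrite (e_fun pw pw').
(* The walk is back at [x], so its next vertex is the successor of [x] on the cycle, from which [a]
   and then [x] are reached; [x = a] is the case of a loop. *)
rewrite lx in pw; apply: connect_trans (connect1 ax).
case: (connect_first xa) => [eax|[w' xw' w'a]]; last by rewrite (e_fun pw xw').
by rewrite (e_fun pw (_ : e x x)) // {1}eax.
Qed.

Lemma sink_unique x a a' :
  sink a -> sink a' -> connect e x a -> connect e x a' -> a = a'.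
Proof.
move=> sa sa' xa xa'; case/orP: (connect_fork xa xa'); first exact: sink_connect.
by move=> a'a; rewrite (sink_connect sa' a'a).
Qed.

Lemma source_reach_sink x : source x -> exists2 a, sink a & connect e x a.
Proof. by move=> /forallP sx; case: (reach_sink x) => // -[a]; rewrite (negPf (sx a)). Qed.

(** The successor map is a bijection from the non-sinks onto the non-sources, so the complements are
    equinumerous as well. *)
Lemma card_source_sink : #|[set x | source x]| = #|[set x | sink x]|.
Proof.
apply/eqP; rewrite -(eqn_add2r #|~: [set x | source x]|) cardsC.
rewrite -(cardsC [set x | sink x]) eqn_add2l.
pose f z := odflt z [pick y | e z y].
have ef z y : e z y -> f z = y.
  by move=> zy; rewrite /f; case: pickP => [y' /(e_fun zy)|/(_ y)]; rewrite ?zy.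
have sinkPn z : z \in ~: [set x | sink x] -> e z (f z).
  by rewrite !inE negb_forall => /existsP[y]; rewrite negbK => zy; rewrite (ef _ _ zy).
rewrite -(card_in_imset (f := f) (D := ~: [set x | sink x])); last first.
  move=> u v uD vD fuv; apply: (@e_inj _ _ (f u)); first exact: sinkPn.
  by rewrite fuv sinkPn.
apply/eqP/eq_card => y; apply/imsetP/idP => [[z zD ->]|].
  by rewrite !inE negb_forall; apply/existsP; exists z; rewrite negbK sinkPn.
rewrite !inE negb_forall => /existsP[z]; rewrite negbK => zy; exists z.
  by rewrite !inE negb_forall; apply/existsP; exists y; rewrite negbK.
by rewrite (ef _ _ zy).
Qed.

(** * Components traced out by a maximal path or a cycle *)

Section MaximalPath.
Variables (x : T) (p : seq T).
Hypotheses (xp : path e x p) (Up : uniq (x :: p)).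
Let s := x :: p.
Hypothesis ends : source x && sink (last x p) \/ e (last x p) x.

(** The vertices of the path are closed under arcs in both directions: inside the path by
    uniqueness, at its ends by [ends], which covers a maximal path and a closed cycle together. *)
Lemma component_path : component x = [set y in s].
Proof.
have nthS i : i < size p -> e (nth x s i) (nth x s i.+1).
  by move=> lt; move/pathP: xp => /(_ x i lt).
have clos : closed (fun i j => e i j || e j i) (mem s).
  suff H y z : e y z -> (y \in s) = (z \in s).
    by move=> y z /orP[/H ->//|/H ->].
  move=> yz; apply/idP/idP=> /(nthP x)[i]; rewrite /= ltnS => lei iE.
    move: lei; rewrite leq_eqVlt => /orP[/eqP ie|lti].
      have yE : y = last x p by rewrite -iE ie /s nth_last.
      case: ends => [/andP[_ /forallP/(_ z)]|]; first by rewrite -yE yz.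
      by rewrite -yE => /(e_fun yz) ->; rewrite /s mem_head.
    move: (nthS i lti); rewrite iE => /(e_fun yz) ->.
    by apply: mem_nth; rewrite /= ltnS.
  case: i lei iE => [_ /= zE|i lei iE].
    rewrite -zE in yz; case: ends => [/andP[/forallP/(_ y)]|]; first by rewrite yz.
    by move=> /(e_inj yz) ->; rewrite /s mem_last.
  move: (nthS i lei); rewrite iE => /(e_inj yz) ->.
  by apply: mem_nth; rewrite /= ltnS ltnW.
apply/setP=> y; rewrite [in RHS]inE; apply/idP/idP => [|ys].
  by rewrite inE => /(closed_connect clos); rewrite !inE eqxx => <-.
apply: mem_component; exact: path_connect xp _ ys.
Qed.

Lemma path_arc i j : source x && sink (last x p) -> i < size s -> j < size s ->
  e (nth x s i) (nth x s j) = (j == i.+1).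
Proof.
move=> /andP[_ sl]; rewrite /= !ltnS => li lj; apply/idP/eqP => [|ji].
  move: li; rewrite leq_eqVlt => /orP[/eqP ->|li].
    by rewrite -[size p]/(size s).-1 nth_last /= (negPf (forallP sl _)).
  move/pathP: xp => /(_ x i li); rewrite -[nth x p i]/(nth x s i.+1).
  by move=> /e_fun H /H /eqP; rewrite nth_uniq //= ?ltnS // => /eqP ->.
by rewrite ji in lj *; move/pathP: xp => /(_ x i lj).
Qed.

Lemma cycle_arc i j : e (last x p) x -> i < size s -> j < size s ->
  e (nth x s i) (nth x s j) = (j == i.+1 %% size s).
Proof.
move=> lx; rewrite /= !ltnS => li lj.
have H : e (nth x s i) (nth x s (i.+1 %% size s)).
  move: li; rewrite leq_eqVlt => /orP[/eqP ->|li].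
    by rewrite -[size p]/(size s).-1 nth_last /= modnn.
  by rewrite modn_small //; move/pathP: xp => /(_ x i li).
apply/idP/eqP => [|-> //].
by move=> /(e_fun H)/esym/eqP; rewrite nth_uniq ?ltn_mod //= => /eqP.
Qed.

End MaximalPath.

End PartialInjection.

(** * Paths and cycles of a Laguerre digraph *)

Lemma laguerreP n (G : digraph n) :
  reflect ((forall x y z, has_arc G x y -> has_arc G x z -> y = z) /\
           (forall x y z, has_arc G x z -> has_arc G y z -> x = y))
          (is_laguerre G).
Proof.
apply: (iffP forallP) => [H|[Hf Hi] i].
  split=> x y z.
    case/andP: (H x) => _ /card_le1_eqP Hx xy xz; apply: Hx; by rewrite inE.
  case/andP: (H z) => /card_le1_eqP Hx _ xz yz; apply: Hx; by rewrite inE.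
apply/andP; split; apply/card_le1_eqP=> x y; rewrite !inE => Hx Hy.
  exact: Hi Hy Hx.
exact: Hf Hy Hx.
Qed.

(* A cycle is counted through its largest vertex. *)
Definition cycmax n (e : rel 'I_n) x :=
  oncyc e x && [forall y, connect e x y ==> (y <= x)].

Section Components.
Variables (n : nat) (G : digraph n).
Hypothesis lagG : is_laguerre G.
Let e := has_arc G.
Let ef : forall x y z, e x y -> e x z -> y = z. Proof. by case/laguerreP: lagG. Qed.
Let ei : forall x y z, e x z -> e y z -> x = y. Proof. by case/laguerreP: lagG. Qed.

Lemma componentsE : components G = component e @: [set: 'I_n].
Proof. by apply: eq_imset => x; apply/setP=> y; rewrite !inE. Qed.

Lemma component_closed x y z : y \in component e x -> e y z || e z y -> z \in component e x.
Proof. by move=> yx yz; rewrite (component_eq yx) inE connect1. Qed.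

(** The walk from [x] to the sink it reaches, shortened to distinct vertices, is maximal and hence
    exhausts the component. *)
Lemma source_dipath x : source e x -> is_dipath G (component e x).
Proof.
move=> sx; have [a sa /connectP[q /shortenP[p xp Up _] aE]] := source_reach_sink ei sx.
have ends : source e x && sink e (last x p) by rewrite sx -aE sa.
have cE := component_path ef ei xp (or_introl ends).
have sz : size (x :: p) == #|component e x| by rewrite cE cardsE (card_uniqP Up).
apply/existsP; exists (Tuple sz); rewrite {1}cE eqxx /=.
apply/forallP=> i; apply/forallP=> j; rewrite !(tnth_nth x) /=.
by rewrite -/e (path_arc ef xp Up ends) //= [(size p).+1](eqP sz).
Qed.

Lemma oncyc_dicycle x : oncyc e x -> is_dicycle G (component e x).
Proof.
case/existsP=> a /andP[ax /connectP[q /shortenP[p xp Up _] aE]].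
have ends : e (last x p) x by rewrite -aE.
have cE := component_path ef ei xp (or_intror ends).
have sz : size (x :: p) == #|component e x| by rewrite cE cardsE (card_uniqP Up).
apply/existsP; exists (Tuple sz); rewrite {1}cE eqxx /=.
apply/forallP=> i; apply/forallP=> j; rewrite !(tnth_nth x) /=.
by rewrite -/e (cycle_arc ef xp Up ends) //= [(size p).+1](eqP sz).
Qed.

Lemma dipath_source C : C \in components G -> is_dipath G C ->
  exists2 x, source e x & C = component e x.
Proof.
rewrite componentsE => /imsetP[y _ CE] /existsP[t /andP[/eqP tE /forallP tarc]].
have C0 : 0 < #|C| by apply/card_gt0P; exists y; rewrite CE mem_component.
pose x := tnth t (Ordinal C0).
have xC : x \in C by rewrite tE inE mem_tnth.
exists x; last by rewrite CE; apply: component_eq; rewrite -CE.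
apply/forallP=> z; apply/negP=> zx.
have: z \in C by rewrite CE; apply: (@component_closed _ x); rewrite -?CE // zx orbT.
rewrite tE inE => /tnthP[i zi].
(* An arc into the first vertex, at index 0, would require 0 to be a successor. *)
by have /forallP/(_ (Ordinal C0))/eqP := tarc i; rewrite -zi -/x -/(e z x) zx.
Qed.

(** Otherwise [x] would reach a sink in [C], yet every vertex of the tuple has an arc to the
    cyclically next one. *)
Lemma dicycle_oncyc C x : C \in components G -> is_dicycle G C -> x \in C ->
  oncyc e x.
Proof.
rewrite componentsE => /imsetP[y _ CE] /existsP[t /andP[/eqP tE /forallP tarc]] xC.
have [|[a ax xa]] := reach_sink ei x; last by apply/existsP; exists a; rewrite ax.
case=> a /forallP sa xa; have: a \in C.
  by move: xC; rewrite CE => /component_eq ->; apply: mem_component.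
rewrite tE inE => /tnthP[i ai].
have C0 : 0 < #|C| by apply: leq_ltn_trans (ltn_ord i).
have /forallP/(_ (Ordinal (ltn_pmod i.+1 C0)))/eqP := tarc i.
by rewrite -ai -/(e _ _) (negPf (sa _)) eqxx.
Qed.

(** Each path component contains exactly one source, its start, so sources represent the paths. *)
Lemma npathsE : npaths G = #|[set x | source e x]|.
Proof.
rewrite /npaths -(card_in_imset (f := component e)) => [|x y].
  apply/eq_card=> C; rewrite !inE; apply/andP/imsetP=> [[CG Cp]|[x]].
    by have [x sx ->] := dipath_source CG Cp; exists x; rewrite ?inE.
  rewrite inE => sx ->; split; last exact: source_dipath.
  by rewrite componentsE imset_f.
rewrite !inE => sx sy cxy; have /(component_total ef ei) : y \in component e x.
  by rewrite cxy mem_component.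
by case/orP=> [/source_connect ->|/source_connect ->].
Qed.

Lemma cycE : cyc G = #|[set x | cycmax e x]|.
Proof.
rewrite /cyc -(card_in_imset (f := component e)) => [|x y].
  apply/eq_card=> C; rewrite !inE; apply/andP/imsetP=> [[CG Cp]|[x]].
    have /imsetP[y _ CE] : C \in component e @: setT by rewrite -componentsE.
    have yC : y \in C by rewrite CE mem_component.
    case: (arg_maxnP (fun x : 'I_n => x : nat) yC) => x xC xmax.
    have xE : C = component e x by rewrite CE; apply: component_eq; rewrite -CE.
    exists x => //; rewrite inE /cycmax (dicycle_oncyc CG) //.
    apply/forallP=> z; apply/implyP=> xz.
    have zC : z \in C by rewrite xE mem_component.
    exact: xmax.
  rewrite inE => /andP[sx _] ->; split; last exact: oncyc_dicycle.
  by rewrite componentsE imset_f.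
rewrite !inE => /andP[sx /forallP mx] /andP[sy /forallP my] cxy.
have [xy yx] : connect e x y /\ connect e y x.
  have /(component_total ef ei) : y \in component e x by rewrite cxy mem_component.
  by case/orP=> [xy|yx]; split=> //; apply: oncyc_back.
apply/val_inj/eqP; rewrite eqn_leq.
by rewrite (implyP (my x) yx) (implyP (mx y) xy).
Qed.

End Components.

(** * Peaks, valleys and records *)

Section VertexTypes.
Variables (n : nat) (e : rel 'I_n).

(** Comparison of [i] with a neighbour letter, the vertex satisfying [P]: a missing neighbour, which
    stands for infinity, makes [low] false and [high] true. *)
Definition low (P : pred 'I_n) (i : 'I_n) := [exists j : 'I_n, (j < i) && P j].
Definition high (P : pred 'I_n) (i : 'I_n) := [forall j : 'I_n, P j ==> (i < j)].

Definition valleyb i := high (e^~ i) i && high (e i) i.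
Definition peakb i := low (e^~ i) i && low (e i) i.

(* For a peak [i] with successor [j], the letters of the predecessor word to the
   left of position [j] are all below [i]. *)
Definition recordb (i : 'I_n) :=
  [exists j : 'I_n, [&& j < i, e i j &
    [forall l : 'I_n, (l < j) ==> low (e^~ l) i]]].

Lemma lowP (P : pred 'I_n) (i : 'I_n) :
  reflect (exists2 j : 'I_n, j < i & P j) (low P i).
Proof. by apply: (iffP existsP) => [[j /andP[]]|[j ji Pj]]; exists j; rewrite ?ji. Qed.

Lemma eq_low P Q i : P =1 Q -> low P i = low Q i.
Proof. by move=> PQ; apply: eq_existsb => j; rewrite PQ. Qed.

Lemma peakb_valleyb i : peakb i -> ~~ valleyb i.
Proof.
case/andP=> /lowP[j ji Pj] _; apply/negP=> /andP[/forallP/(_ j)].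
by rewrite Pj /= ltnNge ltnW.
Qed.

End VertexTypes.

Section Letters.
Variables (n : nat) (P : pred 'I_n).
Hypothesis P_unique : forall x y, P x -> P y -> x = y.

Lemma letter_lt_low i : letter_lt [pick j | P j] (Some i) = low P i.
Proof.
case: pickP => [j Pj|noP] /=; apply/esym; last first.
  by apply/lowP=> -[j _]; rewrite noP.
by apply/lowP/idP => [[j' j'i /(P_unique Pj) ->]|ji] //; exists j.
Qed.

Lemma letter_lt_high i : letter_lt (Some i) [pick j | P j] = high P i.
Proof.
case: pickP => [j Pj|noP] /=; apply/esym; last first.
  by apply/forallP=> j; rewrite noP.
apply/forallP/idP => [/(_ j)|ij j']; first by rewrite Pj.
by apply/implyP=> /(P_unique Pj) <-.
Qed.

End Letters.

Section Laguerre.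
Variables (n : nat) (G : digraph n).
Hypothesis lagG : is_laguerre G.
Let e := has_arc G.
Let ef : forall x y z, e x y -> e x z -> y = z. Proof. by case/laguerreP: lagG. Qed.
Let ei : forall x y z, e x z -> e y z -> x = y. Proof. by case/laguerreP: lagG. Qed.
Let ep z : forall x y, e x z -> e y z -> x = y. Proof. by move=> x y; apply: ei. Qed.
Let es z : forall x y, e z x -> e z y -> x = y. Proof. by move=> x y; apply: ef. Qed.

Lemma peakE i : peak G i = peakb e i.
Proof. by rewrite /peak !letter_lt_low //; [apply: es|apply: ep]. Qed.

Lemma valleyE i : valley G i = valleyb e i.
Proof. by rewrite /valley !letter_lt_high //; [apply: es|apply: ep]. Qed.

Lemma alternatingE : alternating G = [forall i, peakb e i || valleyb e i].
Proof.
apply: eq_forallb => i; rewrite -peakE -valleyE.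
rewrite /double_ascent /double_descent /fixed_point /peak /valley.
(* A loop is seen from both sides, which excludes the mixed cases where only one neighbour equals
   [i]. *)
have : (pred_of G i == Some i) = (succ_of G i == Some i).
  rewrite /pred_of /succ_of; apply/eqP/eqP; case: pickP => // j ij [ji];
    rewrite ji in ij; case: pickP => [k ik|/(_ i)]; rewrite ?ij //.
    by rewrite (ef ij ik).
  by rewrite (ei ij ik).
case: (pred_of G i) => [p|]; case: (succ_of G i) => [s|] //=;
  rewrite ?(inj_eq Some_inj) -?val_eqE /=.
- by case: (ltngtP p i); case: (ltngtP s i).
- by case: (ltngtP p i).
- by case: (ltngtP s i).
Qed.

(** The letter [i] occurs in the predecessor word only at the position of its successor, and at a
    peak that successor exists and lies below [i]. *)
Lemma record_valueE i : peak G i -> record_value G (Some i) = recordb e i.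
Proof.
rewrite peakE => /andP[_ /lowP[j ji ij]].
have predj k : e i k -> pred_of G k = Some i.
  rewrite /pred_of => ik; case: pickP => [m mk|/(_ i)]; last by rewrite -/e ik.
  by rewrite (ei mk ik).
apply/existsP/existsP=> [[k /andP[/eqP ik /forallP H]]|[k /and3P[_ ik /forallP H]]].
  exists k; move: ik; rewrite {1}/pred_of; case: pickP => // m mk [im].
  rewrite -{m}im -/e in mk; rewrite mk (ef mk ij) ji /=.
  apply/forallP=> l; have := H l; rewrite (predj _ mk) (ef mk ij).
  by rewrite letter_lt_low //; apply: ep.
exists k; rewrite (predj _ ik) eqxx /=; apply/forallP=> l.
by rewrite letter_lt_low ?H //; apply: ep.
Qed.

End Laguerre.

Definition good n (G : digraph n) := is_laguerre G && alternating G.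

(** * Inserting the largest vertex *)

Lemma forallS n (P : pred 'I_n.+1) :
  [forall j, P j] = [forall j : 'I_n, P (lift ord_max j)] && P ord_max.
Proof.
apply/forallP/andP => [H|[/forallP H Hm] j]; last by case: (unliftP ord_max j) => [i|] ->.
by split; [apply/forallP=> j|].
Qed.

Lemma existsS n (P : pred 'I_n.+1) :
  [exists j, P j] = [exists j : 'I_n, P (lift ord_max j)] || P ord_max.
Proof.
apply: negb_inj; rewrite negb_or !negb_exists; exact: forallS (fun j => ~~ P j).
Qed.

Lemma big_ord_recm (R : Type) (idx : R) (op : Monoid.law idx) n (F : 'I_n.+1 -> R) :
  \big[op/idx]_i F i = op (\big[op/idx]_(i < n) F (lift ord_max i)) (F ord_max).
Proof.
rewrite big_ord_recr; congr (op _ _); apply: eq_bigr => i _; congr (F _).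
by apply: ord_inj; rewrite lift_max.
Qed.

Lemma card_sumE n (P : pred 'I_n) : #|[set x | P x]| = \sum_x P x.
Proof.
rewrite cardsE -sum1_card big_mkcond; apply: eq_bigr => x _.
by rewrite unfold_in; case: (P x).
Qed.

Lemma big_option (R : Type) (idx : R) (op : Monoid.com_law idx) (T : finType)
    (P : pred (option T)) (F : option T -> R) :
  \big[op/idx]_(x | P x) F x =
  op (if P None then F None else idx) (\big[op/idx]_(x | P (Some x)) F (Some x)).
Proof.
rewrite big_mkcond (bigD1 None) //= -big_mkcondr; congr (op _ _).
rewrite (reindex_omap Some id) => [|[x|]] //=.
by apply: eq_bigl => x; rewrite eqxx andbT.
Qed.

Section Extension.
Variable n : nat.
Local Notation up := (lift (@ord_max n)).

(* The new top vertex is isolated, or is inserted between the end [a] and the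
   start [b] of two (possibly equal) paths. *)
Definition extend (G : digraph n) (ab : option ('I_n * 'I_n)) : digraph n.+1 :=
  [set xy | match unlift ord_max xy.1, unlift ord_max xy.2 with
    | Some x, Some y => has_arc G x y
    | Some x, None => Some x == omap fst ab
    | None, Some y => Some y == omap snd ab
    | None, None => false
    end].

Definition restrict (H : digraph n.+1) : digraph n :=
  [set xy | has_arc H (up xy.1) (up xy.2)].

(** The value is [None] also if only one neighbour exists; in an alternating digraph the top vertex
    has both neighbours or neither. *)
Definition junction (H : digraph n.+1) : option ('I_n * 'I_n) :=
  if [pick a | has_arc H (up a) ord_max] is Some a then
    if [pick b | has_arc H ord_max (up b)] is Some b then Some (a, b) else None
  else None.

Definition joinable (G : digraph n) (ab : option ('I_n * 'I_n)) :=
  if ab is Some (a, b) then sink (has_arc G) a && source (has_arc G) b else true.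

Section Arcs.
Variables (G : digraph n) (ab : option ('I_n * 'I_n)).
Local Notation e := (has_arc G).
Local Notation e' := (has_arc (extend G ab)).

Lemma extend_ll x y : e' (up x) (up y) = e x y.
Proof. by rewrite /has_arc inE /= !liftK. Qed.
Lemma extend_lm x : e' (up x) ord_max = (Some x == omap fst ab).
Proof. by rewrite /has_arc inE /= liftK unlift_none. Qed.
Lemma extend_ml y : e' ord_max (up y) = (Some y == omap snd ab).
Proof. by rewrite /has_arc inE /= liftK unlift_none. Qed.
Lemma extend_mm : e' ord_max ord_max = false.
Proof. by rewrite /has_arc inE /= unlift_none. Qed.
End Arcs.

Definition extendE := (extend_ll, extend_lm, extend_ml, extend_mm).

(** * Vertex types, records and validity of an extension *)

Section Vertices.
Variables (G : digraph n) (ab : option ('I_n * 'I_n)).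
Local Notation e := (has_arc G).
Local Notation e' := (has_arc (extend G ab)).

Lemma restrict_extend : restrict (extend G ab) = G.
Proof. by apply/setP=> -[x y]; rewrite inE /= extendE. Qed.

Lemma junction_extend : junction (extend G ab) = ab.
Proof.
rewrite /junction; case: pickP => [a|noa].
  rewrite extendE; case: ab => [[a' b']|] // /eqP[->].
  case: pickP => [b|/(_ b')]; rewrite extendE ?eqxx //.
  by move=> /eqP[->].
case: ab noa => [[a' b']|] // /(_ a').
by rewrite extendE eqxx.
Qed.

(** The top vertex exceeds every old vertex, so as a neighbour it compares like the infinite letter
    it replaces; old vertices therefore keep their types. *)
Lemma high_pred_up i : high (e'^~ (up i)) (up i) = high (e^~ i) i.
Proof.
rewrite /high forallS !lift_max ltn_ord implybT andbT.
by apply: eq_forallb => j; rewrite !lift_max extendE.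
Qed.

Lemma high_succ_up i : high (e' (up i)) (up i) = high (e i) i.
Proof.
rewrite /high forallS !lift_max ltn_ord implybT andbT.
by apply: eq_forallb => j; rewrite !lift_max extendE.
Qed.

Lemma low_up (P : pred 'I_n.+1) i : low P (up i) = low (P \o up) i.
Proof.
rewrite /low existsS !lift_max [_ < i]ltnNge (ltnW (ltn_ord i)) andFb orbF.
by apply: eq_existsb => j; rewrite !lift_max.
Qed.

Lemma valleyb_up i : valleyb e' (up i) = valleyb e i.
Proof. by rewrite /valleyb high_pred_up high_succ_up. Qed.

Lemma peakb_up i : peakb e' (up i) = peakb e i.
Proof.
by rewrite /peakb !low_up; congr (_ && _); apply: eq_low => j /=; rewrite extendE.
Qed.

(** Replacing an infinite letter of the predecessor word by the top vertex leaves it above [i], so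
    old record conditions are unaffected. *)
Lemma recordb_up i : recordb e' (up i) = recordb e i.
Proof.
rewrite /recordb existsS !lift_max [_ < i]ltnNge (ltnW (ltn_ord i)) andFb orbF.
apply: eq_existsb => j; rewrite !lift_max extendE; congr [&& _, _ & _].
rewrite forallS [_ < j]ltnNge (ltnW (ltn_ord j)) implyFb andbT.
apply: eq_forallb => l; rewrite !lift_max low_up; congr (_ ==> _).
by apply: eq_low => m /=; rewrite extendE.
Qed.

Lemma valleyb_max : valleyb e' ord_max = (ab == None).
Proof.
rewrite /valleyb /high !forallS extend_mm !implyFb !andbT.
case: ab => [[a b]|]; [rewrite -[RHS]/false | rewrite -[RHS]/true].
  apply/negP=> /andP[/forallP/(_ a)]; rewrite lift_max extendE eqxx implyTb.
  by rewrite ltnNge ltnW.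
by apply/andP; split; apply/forallP=> j; rewrite extendE.
Qed.

Lemma peakb_max : peakb e' ord_max = (ab != None).
Proof.
rewrite /peakb /low !existsS extend_mm !andbF !orbF.
case: ab => [[a b]|]; [rewrite -[RHS]/true | rewrite -[RHS]/false]; last first.
  by apply/negP=> /andP[/existsP[j]]; rewrite extendE andbF.
by apply/andP; split; apply/existsP; [exists a|exists b];
  rewrite extendE eqxx lift_max ltn_ord.
Qed.

Lemma source_up y : source e' (up y) = source e y && (Some y != omap snd ab).
Proof.
rewrite /source forallS extendE; congr (_ && _).
by apply: eq_forallb => x; rewrite extendE.
Qed.

Lemma source_max : source e' ord_max = (ab == None).
Proof.
rewrite /source forallS extendE andbT; case: ab => [[a b]|] /=.
  by apply/negP=> /forallP/(_ a); rewrite extendE eqxx.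
by apply/forallP=> x; rewrite extendE.
Qed.

(** Degrees stay at most 1 exactly when the new arcs leave a sink and enter a source. Alternation
    needs no condition on [ab]: old types persist and the top vertex is a valley or a peak. *)
Lemma good_extend : good (extend G ab) = good G && joinable G ab.
Proof.
rewrite /good; case: (boolP (is_laguerre (extend G ab))) => lag'; last first.
  apply/esym/negP=> /andP[/andP[lagG _] J]; case/negP: lag'; apply/laguerreP.
  have [ef ei] := laguerreP _ lagG.
  have [Jl Jr] : (forall x y, e x y -> Some x == omap fst ab -> false) /\
    (forall x y, e x y -> Some y == omap snd ab -> false).
    case: ab J => [[a b]|] // /andP[/forallP sa /forallP sb].
    by split=> x y xy /eqP[E]; [have := sa y|have := sb x]; rewrite -E xy.
  (* Case split on which of the three vertices is the top one; mixed cases contradict [Jl] or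
     [Jr]. *)
  split=> x y z;
    case: (unliftP ord_max x) => [x'|] ->; case: (unliftP ord_max y) => [y'|] ->;
    case: (unliftP ord_max z) => [z'|] ->; rewrite ?extendE //.
  - by move=> /ef H /H ->.
  - by move=> /Jl H /H.
  - by move=> H /Jl /(_ H).
  - by move=> /eqP <- /eqP[->].
  - by move=> /ei H /H ->.
  - by move=> /eqP <- /eqP[->].
  - by move=> /Jr H /H.
  - by move=> H /Jr /(_ H).
have [ef' ei'] := laguerreP _ lag'.
have lagG : is_laguerre G.
  apply/laguerreP; split=> x y z; rewrite -!(extend_ll G ab).
    by move=> /ef' H /H /lift_inj.
  by move=> /ei' H /H /lift_inj.
have J : joinable G ab.
  case: ab ef' ei' {lag'} => [[a b]|] // ef' ei'.
  apply/andP; split; apply/forallP=> y; apply/negP; rewrite -(extend_ll G (Some (a, b))).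
    move=> /(ef' _ _ ord_max); rewrite extendE eqxx => /(_ isT) /eqP.
    by rewrite eq_sym (negPf (neq_lift _ _)).
  move=> /(ei' _ ord_max); rewrite extendE eqxx => /(_ isT) /eqP.
  by rewrite eq_sym (negPf (neq_lift _ _)).
rewrite lagG J !alternatingE // andbT /= forallS peakb_max valleyb_max.
rewrite orNb andbT; apply: eq_forallb => i; by rewrite peakb_up valleyb_up.
Qed.

End Vertices.

Lemma extend_restrict (H : digraph n.+1) :
  good H -> extend (restrict H) (junction H) = H.
Proof.
case/andP=> lagH; rewrite alternatingE // => /forallP/(_ ord_max) alt.
have [ef ei] := laguerreP _ lagH.
(* A vertex carrying a loop is neither a peak nor a valley. *)
have mm : has_arc H ord_max ord_max = false.
  apply/negP=> mm; case/orP: alt => /andP[].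
    by case/lowP=> j jm /(ei _ _ _ mm) jE; rewrite -jE ltnn in jm.
  by move=> /forallP/(_ ord_max); rewrite mm ltnn.
have jl : omap fst (junction H) = [pick a | has_arc H (up a) ord_max] /\
          omap snd (junction H) = [pick b | has_arc H ord_max (up b)].
  rewrite /junction; case/orP: alt => [/andP[/lowP[a am aH] /lowP[b bm bH]]|].
    case: pickP => [a' _|na]; last first.
      case: (unliftP ord_max a) => [a'|] aE; rewrite aE ?mm // in aH.
      by rewrite na in aH.
    case: pickP => [b' _|nb] //.
    case: (unliftP ord_max b) => [b'|] bE; rewrite bE ?mm // in bH.
    by rewrite nb in bH.
  case/andP=> /forallP Ha /forallP Hb.
  case: pickP => [a aH|na].
    by have := Ha (up a); rewrite aH implyTb lift_max ltnNge ltnW.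
  case: pickP => [b bH|nb] //.
  by have := Hb (up b); rewrite bH implyTb lift_max ltnNge ltnW.
apply/setP=> -[x y]; rewrite -!/(has_arc _ _ _).
case: (unliftP ord_max x) => [x'|] ->; case: (unliftP ord_max y) => [y'|] ->;
  rewrite extendE ?mm //.
- by rewrite /has_arc inE.
- rewrite jl.1; case: pickP => [a aH|na]; last by rewrite na.
  by apply/eqP/idP=> [[->]//|/(ei _ _ _ aH) /lift_inj ->].
- rewrite jl.2; case: pickP => [a aH|na]; last by rewrite na.
  by apply/eqP/idP=> [[->]//|/(ef _ _ _ aH) /lift_inj ->].
Qed.

End Extension.

(** * Cycles, path starts and records after an insertion *)

Section Cycles.
Variables (n : nat) (G : digraph n).
Local Notation up := (lift (@ord_max n)).
Local Notation e := (has_arc G).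

Section Connect.
Variable ab : option ('I_n * 'I_n).
Local Notation e' := (has_arc (extend G ab)).

Lemma connect_up x y : connect e x y -> connect e' (up x) (up y).
Proof.
case/connectP=> p; elim: p x => [|z p IH] x /=; first by move=> _ ->.
case/andP=> xz zp yE; apply: connect_trans (IH _ zp yE).
by apply: connect1; rewrite extendE.
Qed.

Lemma connect_avoid_max x v :
    (forall y, connect e x y -> ~~ e' (up y) ord_max) ->
  connect e' (up x) v -> exists2 y, v = up y & connect e x y.
Proof.
move=> avoid /connectP[p]; elim/last_ind: p v => [|p w IH] v.
  by move=> _ ->; exists x.
rewrite rcons_path last_rcons => /andP[xp pw] ->.
have [y yE xy] := IH _ xp erefl; rewrite yE in pw.
case: (unliftP ord_max w) pw => [z|] ->; last by rewrite (negPf (avoid y xy)).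
by rewrite extendE => yz; exists z => //; apply: connect_trans xy (connect1 yz).
Qed.

(** A cycle whose maximum is old misses the top vertex, and an old cycle contains no sink, so the
    arc into the top vertex cannot start on it. *)
Lemma cycmax_up x : is_laguerre G -> joinable G ab ->
  cycmax e' (up x) = cycmax e x.
Proof.
move=> /laguerreP[ef ei] J; apply/andP/andP => -[/existsP[a /andP[ax xa]] /forallP xmax].
  have avoid y : connect e x y -> ~~ e' (up y) ord_max.
    move=> xy; apply/negP=> ym.
    have := xmax ord_max; rewrite (connect_trans (connect_up xy) (connect1 ym)).
    by rewrite implyTb lift_max leqNgt ltn_ord.
  have [y aE xy] := connect_avoid_max avoid xa.
  split; last first.
    apply/forallP=> z; apply/implyP=> /connect_up xz.
    by have := implyP (xmax _) xz; rewrite !lift_max.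
  by apply/existsP; exists y; rewrite xy -(extend_ll G ab) -aE ax.
have onx : oncyc e x by apply/existsP; exists a; rewrite ax.
have avoid y : connect e x y -> ~~ e' (up y) ord_max.
  move=> xy; rewrite extendE; apply/negP.
  case: ab J => [[c d]|] // /andP[sc _] /eqP[yc]; rewrite {y}yc in xy.
  have xE := sink_connect sc (oncyc_back ef onx xy).
  rewrite xE in sc; case: (connect_first xa) => [xa'|[w xw _]].
    by have := forallP sc x; rewrite {1}xa' ax.
  by have := forallP sc w; rewrite xw.
split; first by apply/existsP; exists (up a); rewrite extendE ax connect_up.
apply/forallP=> v; apply/implyP=> /(connect_avoid_max avoid)[y -> xy].
by rewrite !lift_max (implyP (xmax y)).
Qed.

End Connect.

Lemma cycmax_max_None : cycmax (has_arc (extend G None)) ord_max = false.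
Proof.
apply/negP=> /andP[/existsP[a /andP[am _]] _]; move: am.
by case: (unliftP ord_max a) => [a'|] ->; rewrite extendE.
Qed.

(** A walk that visits the top vertex must enter it from [a], so its initial part among old vertices
    already reaches [a]. *)
Lemma connect_end (a b x : 'I_n) :
  connect (has_arc (extend G (Some (a, b)))) (up x) (up a) -> connect e x a.
Proof.
case/connectP=> p; elim: p x => [|v p IH] x /=.
  by move=> _ /lift_inj ->.
case/andP; case: (unliftP ord_max v) => [z|] ->; rewrite extendE; last first.
  by move=> /eqP[->].
by move=> xz zp aE; apply: connect_trans (connect1 xz) (IH _ zp aE).
Qed.

(** The only passage through the top vertex is from [a] to [b], so a cycle closes exactly when [b]
    leads to [a]; its maximum is then the top vertex. *)
Lemma cycmax_max_Some a b :
  cycmax (has_arc (extend G (Some (a, b)))) ord_max = connect e b a.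
Proof.
apply/andP/idP=> [[/existsP[v /andP[vm mv]] _]|ba].
  case: (unliftP ord_max v) vm mv => [a'|] ->; rewrite extendE // => /eqP[->].
  case/connect_first => [/eqP|[w]]; first by rewrite (negPf (neq_lift _ _)).
  case: (unliftP ord_max w) => [b'|] ->; rewrite extendE // => /eqP[->].
  exact: connect_end.
split; last by apply/forallP=> v; apply/implyP=> _; apply: leq_ord.
apply/existsP; exists (up a); rewrite extendE eqxx /=.
apply: connect_trans (connect_up _ ba); apply: connect1.
by rewrite extendE.
Qed.

Lemma card_source_None :
  #|[set x | source (has_arc (extend G None)) x]| = #|[set x | source e x]|.+1.
Proof.
rewrite !card_sumE big_ord_recm source_max eqxx /= addn1; congr _.+1.
by apply: eq_bigr => x _; rewrite source_up andbT.
Qed.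

(** Among the starts only [b] is lost, and the top vertex has a predecessor. *)
Lemma card_source_Some a b : source e b ->
  (#|[set x | source (has_arc (extend G (Some (a, b)))) x]|).+1 =
  #|[set x | source e x]|.
Proof.
move=> sb; rewrite [RHS](cardsD1 b) inE sb add1n; congr _.+1.
have -> : [set x | source e x] :\ b = [set x | source e x && (x != b)].
  by apply/setP=> x; rewrite !inE andbC.
rewrite !card_sumE big_ord_recm source_max /= addn0.
by apply: eq_bigr => x _; rewrite source_up.
Qed.

(** The top vertex is the letter at position [b] and exceeds all other finite letters, so it is a
    record unless an infinite letter, that is a source, precedes it. *)
Lemma recordb_max a b :
  recordb (has_arc (extend G (Some (a, b)))) ord_max =
  [forall l : 'I_n, (l < b) ==> ~~ source e l].
Proof.
rewrite /recordb existsS ltnn orbF; apply/existsP/idP => [[j]|H].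
  rewrite extendE => /and3P[_ /eqP[->]]; rewrite forallS => /andP[/forallP H _].
  apply/forallP=> l; apply/implyP=> lb; have := H l; rewrite !lift_max lb implyTb.
  case/lowP=> m _; case: (unliftP ord_max m) => [m'|] ->; rewrite extendE.
    by move=> ml; rewrite negb_forall; apply/existsP; exists m'; rewrite negbK.
  by move=> /eqP[lE]; rewrite lE ltnn in lb.
exists b; rewrite extendE eqxx lift_max ltn_ord !andTb forallS.
rewrite [_ < b]ltnNge (ltnW (ltn_ord b)) implyFb andbT.
apply/forallP=> l; rewrite lift_max; apply/implyP=> lb.
have := implyP (forallP H l) lb; rewrite negb_forall => /existsP[m].
rewrite negbK => ml; apply/lowP; exists (up m); last by rewrite extendE.
by rewrite lift_max.
Qed.

End Cycles.

Import Num.Theory Order.TTheory.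
Local Open Scope ring_scope.

(** * Weights *)

(* Here [m] is the integer label, i.e. the ordinal plus one. *)
Definition xw (m : nat) : Zpoly7 := if odd m then xo else xe.
Definition yw (m : nat) : Zpoly7 := if odd m then yo else ye.
Definition uw (m : nat) : Zpoly7 := if odd m then uo else ue.

Definition vertex_weight n (e : rel 'I_n) (i : 'I_n) : Zpoly7 :=
  if valleyb e i then yw i.+1 else if recordb e i then xw i.+1 else uw i.+1.

Definition weight n (G : digraph n) : Zpoly7 :=
  (\prod_i vertex_weight (has_arc G) i) * lam ^+ #|[set x | cycmax (has_arc G) x]|.

Lemma expr_card (R : comNzRingType) n (x : R) (P : pred 'I_n) :
  x ^+ #|[set i | P i]| = \prod_i (if P i then x else 1).
Proof. by rewrite -prodr_const big_mkcond; apply: eq_bigr => i _; rewrite inE. Qed.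

(** Each power becomes a product over all vertices; at a given vertex exactly one of the six factors
    is selected. *)
Lemma weightE n (G : digraph n) : is_laguerre G -> alternating G ->
  xe ^+ Ae G * ye ^+ Ve G * ue ^+ Be G *
    xo ^+ Ao G * yo ^+ Vo G * uo ^+ Bo G * lam ^+ cyc G = weight G.
Proof.
move=> lagG; rewrite alternatingE // => /forallP altG.
rewrite cycE // /weight; congr (_ * _).
rewrite /Ae /Ve /Be /Ao /Vo /Bo !expr_card -!big_split /=.
apply: eq_bigr => i _; rewrite /vertex_weight /even_vertex /odd_vertex.
rewrite valleyE //; have := @record_valueE _ _ lagG i; rewrite peakE //.
have := @peakb_valleyb _ (has_arc G) i; have := altG i.
case: peakb => /=; last first.
  by move=> -> _ _; rewrite !andbF !andbT /yw /=; case: odd; rewrite /= ?mulr1 ?mul1r.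
move=> _ /(_ isT)/negPf -> /(_ isT) ->; rewrite !andbF /xw /uw /=.
by case: odd; case: recordb; rewrite /= ?mulr1 ?mul1r.
Qed.

Lemma QhatE n k : Qhat n k =
  \sum_(G : digraph n | good G && (#|[set x | source (has_arc G) x]| == k)) weight G.
Proof.
rewrite /Qhat; apply: eq_big => [G|G].
  rewrite inE /good -andbA; apply: andb_id2l => lagG; congr (_ && _).
  by rewrite npathsE.
by rewrite inE => /and3P[lagG altG _]; rewrite weightE.
Qed.

(** * Lattice paths *)

Section PathRecursion.
Variables (R : comNzRingType) (alpha : nat -> R).

Lemma tnth_rcons_widen (T : Type) N (t : N.-tuple T) s i :
  tnth (rcons_tuple t s) (widen_ord (leqnSn N) i) = tnth t i.
Proof. by rewrite !(tnth_nth s) /= nth_rcons size_tuple ltn_ord. Qed.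

Lemma tnth_rcons_max (T : Type) N (t : N.-tuple T) s :
  tnth (rcons_tuple t s) ord_max = s.
Proof. by rewrite !(tnth_nth s) /= nth_rcons size_tuple ltnn eqxx. Qed.

Lemma height_rcons N (t : N.-tuple bool) s j : (j <= N)%N ->
  height (rcons_tuple t s) j = height t j.
Proof.
move=> jN; rewrite /height big_mkcond big_ord_recr /= ltnNge jN addr0 [RHS]big_mkcond.
by apply: eq_bigr => i _; rewrite tnth_rcons_widen.
Qed.

Lemma height_rconsS N (t : N.-tuple bool) s :
  height (rcons_tuple t s) N.+1 = height t N + (if s then 1 else -1).
Proof.
rewrite /height big_mkcond big_ord_recr /= ltnSn tnth_rcons_max; congr (_ + _).
rewrite [RHS]big_mkcond; apply: eq_bigr => i _.
by rewrite tnth_rcons_widen ltn_ord ltnW // ltnS ltn_ord.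
Qed.

(** A final rise cannot end at height 0, whence [0 < K]; a final fall from height [K.+1] ends at a
    nonnegative height automatically. *)
Lemma is_path_rcons N K (t : N.-tuple bool) s :
  is_path K (rcons_tuple t s) =
  if s then (0 < K)%N && is_path K.-1 t else is_path K.+1 t.
Proof.
rewrite /is_path height_rconsS.
have -> : [forall j : 'I_N.+2, 0 <= height (rcons_tuple t s) j] =
  [forall j : 'I_N.+1, 0 <= height t j] && (0 <= height (rcons_tuple t s) N.+1).
  apply/forallP/andP => [H|[/forallP H HN] j].
    split; last exact: (H ord_max).
    apply/forallP=> j; have := H (widen_ord (leqnSn _) j).
    by rewrite height_rcons //; apply: leq_ord j.
  have [jN|Nj] := leqP j N.
    by rewrite height_rcons //; have := H (Ordinal (jN : (j < N.+1)%N)).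
  by have -> : j = N.+1 :> nat by apply/eqP; rewrite eqn_leq Nj -ltnS ltn_ord.
rewrite height_rconsS; set h := height t N.
case: (boolP [forall j, _]) => [/forallP/(_ ord_max)/= h0|_]; last first.
  by case: s; rewrite ?andbF.
rewrite -/h in h0; case: s => /=.
  case: K => [|K] /=; first by rewrite (gt_eqF (ltr_wpDl h0 ltr01)) andbF.
  by rewrite -addn1 PoszD (inj_eq (addIr _)) addr_ge0.
rewrite -[h + -1 == _](inj_eq (addIr 1)) subrK -addn1 PoszD.
by case: eqP => [->|]; rewrite ?andbF // addrK.
Qed.

Lemma path_weight_rcons N (t : N.-tuple bool) s :
  path_weight alpha (rcons_tuple t s) =
  path_weight alpha t * (if s then 1 else alpha `|height t N|%N).
Proof.
rewrite /path_weight big_ord_recr /= tnth_rcons_max height_rcons //; congr (_ * _).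
by apply: eq_bigr => i _; rewrite tnth_rcons_widen height_rcons // ltnW.
Qed.

(** The last step is a rise from [K.-1] of weight 1 or a fall from [K.+1]. *)
Lemma path_polyS N K :
  path_poly alpha N.+1 K =
  (if (0 < K)%N then path_poly alpha N K.-1 else 0) +
  alpha K.+1 * path_poly alpha N K.+1.
Proof.
pose f (p : N.-tuple bool * bool) := rcons_tuple p.1 p.2.
have bij_f : bijective f.
  apply: inj_card_bij => [[t s] [t' s'] /(congr1 val)/= /rcons_inj[tt' ->]|].
    by rewrite (val_inj tt').
  by rewrite card_prod !card_tuple card_bool expnSr.
rewrite /path_poly (reindex f) /=; last exact: onW_bij.
rewrite (eq_bigr (fun p => (fun t s => path_weight alpha (rcons_tuple t s)) p.1 p.2)) //.
under eq_bigl do rewrite is_path_rcons.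
rewrite -(pair_big_dep xpredT (fun t s => if s then (0 < K)%N && is_path K.-1 t
  else is_path K.+1 t) (fun t s => path_weight alpha (rcons_tuple t s))) /=.
under eq_bigr do rewrite big_mkcond big_bool /= !path_weight_rcons mulr1.
rewrite big_split /= -!big_mkcond; congr (_ + _).
  by case: (0 < K)%N => //=; rewrite big_pred0.
rewrite mulr_sumr; apply: eq_bigr => t /andP[_ /eqP ->].
by rewrite absz_nat mulrC.
Qed.

Lemma path_poly0 K : path_poly alpha 0 K = (K == 0%N)%:R.
Proof.
rewrite /path_poly (eq_bigl (fun t => (t == [tuple]) && (K == 0%N))) => [|t].
  case: (K == 0%N); last by rewrite big_pred0 // => t; rewrite andbF.
  by under eq_bigl do rewrite andbT; rewrite big_pred1_eq /path_weight big_ord0.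
rewrite tuple0 eqxx /is_path [X in _ && X]eq_sym /height big_ord0 eqz_nat.
by rewrite andb_idl // => _; apply/forallP=> j; rewrite big_ord0.
Qed.

End PathRecursion.

(** * The recurrence *)

(** Old vertices and old cycles keep their weights, so only the top vertex and the cycle it may
    close contribute. *)
Lemma weight_up n (G : digraph n) ab : is_laguerre G -> joinable G ab ->
  weight (extend G ab) =
  weight G * (vertex_weight (has_arc (extend G ab)) ord_max *
              lam ^+ cycmax (has_arc (extend G ab)) ord_max).
Proof.
move=> lagG J; rewrite /weight big_ord_recm card_sumE big_ord_recm /= exprD.
rewrite card_sumE -!mulrA; congr (_ * _).
  apply: eq_bigr => i _; rewrite /vertex_weight valleyb_up recordb_up.
  by rewrite lift_max.
rewrite mulrCA; congr (_ * _); congr (_ ^+ _).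
by apply: eq_bigr => x _; rewrite cycmax_up.
Qed.

Lemma weight_None n (G : digraph n) : is_laguerre G ->
  weight (extend G None) = yw n.+1 * weight G.
Proof.
move=> lagG; rewrite weight_up // cycmax_max_None mulr1 /vertex_weight.
by rewrite valleyb_max eqxx mulrC.
Qed.

(** The condition singles out the least element of [P]; the other [k] elements contribute [u]. *)
Lemma sum_min (R : nmodType) n (P : pred 'I_n) (x u : R) k :
  #|[set b | P b]| = k.+1 ->
  \sum_(b | P b) (if [forall l : 'I_n, (l < b)%N ==> ~~ P l] then x else u) =
  x + u *+ k.
Proof.
move=> cP; have /card_gt0P[b0] : (0 < #|[set b | P b]|)%N by rewrite cP.
rewrite inE => Pb0; case: (arg_minnP (fun i : 'I_n => i : nat) Pb0) => m Pm mmin.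
have mm : [forall l : 'I_n, (l < m)%N ==> ~~ P l].
  apply/forallP=> l; apply/implyP; apply: contraL => Pl.
  by rewrite -leqNgt mmin.
rewrite (bigD1 m) //= mm; congr (_ + _).
rewrite (eq_bigr (fun _ => u)) => [|b /andP[Pb bm]]; last first.
  case: forallP => // /(_ m); rewrite Pm implybF -leqNgt => bm'.
  by case/negP: bm; rewrite -val_eqE eqn_leq bm' mmin.
rewrite sumr_const; congr (_ *+ _); apply: succn_inj; rewrite -cP.
rewrite (cardsD1 m) inE Pm add1n; congr _.+1; apply: eq_card => b.
by rewrite !inE unfold_in andbC.
Qed.

(** The path starting at [b] ends in exactly one sink, which gives [l]; the other [k] sinks give 1,
    there being as many sinks as sources. *)
Lemma sum_sinks (R : pzSemiRingType) n (G : digraph n) b k (l : R) : is_laguerre G ->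
  #|[set x | source (has_arc G) x]| = k.+1 -> source (has_arc G) b ->
  \sum_(a | sink (has_arc G) a) l ^+ connect (has_arc G) b a = l + k%:R.
Proof.
move=> /laguerreP[ef ei]; rewrite (card_source_sink ef ei) => ck sb.
have [a sa ba] := source_reach_sink ei sb.
rewrite (bigD1 a) //= ba expr1; congr (_ + _).
rewrite (eq_bigr (fun _ => 1)) => [|a' /andP[sa' aa']]; last first.
  case: (boolP (connect _ b a')) => // ba'.
  by rewrite (sink_unique ef sa sa' ba ba') eqxx in aa'.
rewrite sumr_const; congr _%:R; apply: succn_inj; rewrite -ck.
rewrite (cardsD1 a) inE sa add1n; congr _.+1; apply: eq_card => c.
by rewrite !inE unfold_in andbC.
Qed.

Lemma sum_joins n (G : digraph n) k : is_laguerre G ->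
  #|[set x | source (has_arc G) x]| = k.+1 ->
  \sum_(p | joinable G (Some p)) weight (extend G (Some p)) =
  (lam + k%:R) * (xw n.+1 + k%:R * uw n.+1) * weight G.
Proof.
move=> lagG ck.
transitivity (\sum_(a | sink (has_arc G) a) \sum_(b | source (has_arc G) b)
    weight (extend G (Some (a, b)))).
  by rewrite pair_big; apply: eq_big => -[a b].
(* The vertex weight depends on [b] alone, and for fixed [b] the sum of the cycle factors over [a]
   is the same for every [b], so the double sum factors. *)
rewrite exchange_big /=.
rewrite (eq_bigr (fun b : 'I_n =>
   (if [forall l : 'I_n, (l < b)%N ==> ~~ source (has_arc G) l]
    then xw n.+1 else uw n.+1) * ((lam + k%:R) * weight G))) => [|b sb].
  by rewrite -mulr_suml (sum_min _ _ ck) mulr_natl mulrA [_ * (lam + _)]mulrC.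
rewrite -(sum_sinks _ lagG ck sb) mulr_suml mulr_sumr; apply: eq_bigr => a sa.
rewrite weight_up //=; last by rewrite sa.
rewrite cycmax_max_Some /vertex_weight valleyb_max recordb_max /=.
by rewrite mulrC -mulrA.
Qed.

(** Removing the top vertex: an isolated one leaves [k.-1] paths, a peak leaves [k.+1]. Pairs of a
    digraph and a junction index the sum. *)
Lemma QhatS n k :
  Qhat n.+1 k = (if (0 < k)%N then yw n.+1 * Qhat n k.-1 else 0) +
    (lam + k%:R) * (xw n.+1 + k%:R * uw n.+1) * Qhat n k.+1.
Proof.
rewrite QhatE (reindex_onto (fun p => extend p.1 p.2)
  (fun H => (restrict H, junction H))) /=; last first.
  by move=> H /andP[gH _]; apply: extend_restrict.
rewrite (eq_bigl (fun p => good p.1 && (joinable p.1 p.2 &&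
    (#|[set x | source (has_arc (extend p.1 p.2)) x]| == k)))) => [|[G ab]]; last first.
  by rewrite /= restrict_extend junction_extend eqxx andbT good_extend andbA.
rewrite -(pair_big_dep (@good n) (fun G ab => joinable G ab &&
    (#|[set x | source (has_arc (extend G ab)) x]| == k))
    (fun G ab => weight (extend G ab))) /=.
under eq_bigr do rewrite big_option /=.
rewrite big_split /= !QhatE; congr (_ + _).
  rewrite -big_mkcondr; case: k => [|k] /=.
    by rewrite big_pred0 // => G; rewrite card_source_None andbF.
  rewrite mulr_sumr; apply: eq_big => [G|G /andP[/andP[lagG _] _]].
    by rewrite card_source_None eqSS.
  exact: weight_None.
rewrite mulr_sumr [RHS]big_mkcondr; apply: eq_bigr => G /andP[lagG _].
case: eqP => [ck|nk].
  rewrite -sum_joins //; apply: eq_bigl => -[a b]; apply: andb_idr => /andP[_ sb].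
  by rewrite -eqSS card_source_Some // ck.
rewrite big_pred0 // => -[a b]; apply/negP=> /andP[/andP[_ sb] /eqP kE].
by case: nk; rewrite -kE card_source_Some.
Qed.

Lemma Qhat0 k : Qhat 0 k = (k == 0%N)%:R.
Proof.
rewrite QhatE (eq_bigl (fun G => (G == set0) && (k == 0%N))) => [|G].
  case: (k == 0%N); last by rewrite big_pred0 // => G; rewrite andbF.
  under eq_bigl do rewrite andbT.
  by rewrite big_pred1_eq /weight big_ord0 card_sumE big_ord0 mulr1.
rewrite card_sumE big_ord0 [0%N == k]eq_sym; congr (_ && _).
have -> : G = set0 by apply/setP=> -[[]].
rewrite eqxx; apply/andP; split; apply/forallP; case=> //.
Qed.

(** The prefactor is the product of [yw j] over the heights [j] from 1 to [k]: a rise to [k]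
    completes it, and a fall from [k.+1] gives its factor [yw k.+1] to [alpha]. The parity
    hypothesis trades parities of labels for parities of heights. *)
Lemma Qhat_path_poly (alpha : nat -> Zpoly7) n k :
    (forall h, alpha h.+1 = (lam + h%:R) * (xw h + h%:R * uw h) * yw h.+1) ->
  odd n = odd k ->
  Qhat n k = ye ^+ k./2 * yo ^+ uphalf k * path_poly alpha n k.
Proof.
move=> alphaE; elim: n k => [|n IH] k parity.
  by rewrite Qhat0 path_poly0; case: k {parity} => [|k]; rewrite ?mulr0 ?mul1r ?mulr1.
have yk j : ye ^+ j.+1./2 * yo ^+ uphalf j.+1 = yw j.+1 * (ye ^+ j./2 * yo ^+ uphalf j).
  rewrite /yw /= uphalf_half; case: (odd j) => /=.
    by rewrite add1n exprS mulrA.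
  by rewrite add0n exprS mulrCA.
(* The inserted label has the parity of the height reached after the step, hence [xw h] in
   [alpha h.+1]. *)
have [xE uE] : xw n.+1 = xw k /\ uw n.+1 = uw k by rewrite /xw /uw parity.
rewrite QhatS path_polyS [RHS]mulrDr; congr (_ + _); last first.
  rewrite IH; last by rewrite /= -parity /= negbK.
  rewrite yk alphaE xE uE; set E := ye ^+ _ * _.
  by rewrite [RHS]mulrCA -!mulrA.
case: k parity {xE uE} => [|k] parity /=; first by rewrite mulr0.
rewrite IH; last by move: parity => /= /negb_inj.
have -> : yw n.+1 = yw k.+1 by rewrite /yw parity.
by rewrite mulrA -yk.
Qed.

Theorem theorem6p13 (alpha : nat -> {mpoly int[7]})
  (alpha_odd : forall m : nat, (1 <= m)%N ->
     alpha (2 * m - 1)%N =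
       (lam + (2 * m - 2)%:R) * (xe + (2 * m - 2)%:R * ue) * yo)
  (alpha_even : forall m : nat, (1 <= m)%N ->
     alpha (2 * m)%N =
       (lam + (2 * m - 1)%:R) * (xo + (2 * m - 1)%:R * uo) * ye)
  (n k : nat) :
  Qhat (2 * n) (2 * k) = ye ^+ k * yo ^+ k * S_poly alpha n k /\
  Qhat (2 * n + 1) (2 * k + 1) = ye ^+ k * yo ^+ (k + 1) * S'_poly alpha n k.
Proof.
have alphaE h : alpha h.+1 = (lam + h%:R) * (xw h + h%:R * uw h) * yw h.+1.
  (* For odd [h = 2m+1] the index [h.+1 = 2(m+1)] falls under the even formula, for [h = 2m] the
     index [h.+1 = 2(m+1)-1] under the odd one, both taken at [m.+1]. *)
  rewrite /xw /uw /yw -(odd_double_half h); set m := h./2.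
  case: (odd h); rewrite /= odd_double /= -mul2n.
    have -> : (1 + 2 * m).+1 = (2 * m.+1)%N by rewrite mulnS.
    by rewrite alpha_even // mulnS.
  have -> : (0 + 2 * m).+1 = (2 * m.+1 - 1)%N by rewrite mulnS.
  by rewrite alpha_odd // mulnS addKn.
rewrite /S_poly /S'_poly !addn1 !mul2n !(Qhat_path_poly alphaE) /= ?odd_double //.
by rewrite doubleK !uphalf_half odd_double add0n doubleK.
Qed.
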